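(* For each natural number $n$, $$SPT^{-}(n)=\frac{5}{72}M_4(n)-\frac{1}{6}n^2p(n)+\frac{1}{36}np(n)-\mu_4(n).$$
   Context: Notation: $(a;q)_n=\prod_{k=0}^{n-1}(1-aq^k)$, $(a;q)_\infty=\prod_{k\ge0}(1-aq^k)$. The sequence $SPT^{-}(n)$ is defined by $$\sum_{n\ge1}SPT^{-}(n)q^n=\sum_{n_1\ge1}\frac{q^{n_1}}{(1-q^{n_1})^2(q^{n_1+1};q)_{\infty}}\sum_{n_2\ge1}\frac{q^{n_1n_2+n_2}}{(1-q^{n_2})^2(q^{n_2+1};q)_{n_1}}.$$ $p(n)$ is the number of partitions of $n$. $M(m,n)$ is the number of partitions of $n$ with crank $m$, i.e. defined by $\sum_{n\ge0}\sum_{m\in\mathbb{Z}}M(m,n)z^mq^n=\frac{(q;q)_\infty}{(zq;q)_\infty(z^{-1}q;q)_\infty}$. The crank moments are $M_k(n)=\sum_{m\in\mathbb{Z}}m^kM(m,n)$, and the 4-th symmetrized crank is $\mu_4(n)=\sum_{j=-n}^{n}\binom{j+1}{4}M(j,n)$, where $\binom{x}{4}=x(x-1)(x-2)(x-3)/24$ for all integers $x$. *)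

(* Defs.v *)
From HB Require Import structures.
From mathcomp Require Import all_boot all_order all_algebra.
From mathcomp Require Import boolp classical_sets functions cardinality fsbigop.
From mathcomp Require Import zify.

Set Implicit Arguments.
Unset Strict Implicit.
Unset Printing Implicit Defensive.
Import Order.TTheory GRing.Theory Num.Theory.
Local Open Scope ring_scope.

(* Formal power series in q.  A record, so that series do not inherit the
   pointwise ring structure of functions nat -> R. *)

Record fps (R : Type) := Fps { coefq : nat -> R }.
Coercion coefq : fps >-> Funclass.

Lemma fpsP (R : Type) (f g : fps R) : f =1 g <-> f = g.
Proof.
split=> [|-> //]; case: f => f; case: g => g /= fg.
by congr Fps; apply/funext.
Qed.

HB.instance Definition _ (R : Type) := gen_eqMixin (fps R).
HB.instance Definition _ (R : Type) := gen_choiceMixin (fps R).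

Section Ring.
Variable R : comNzRingType.
Implicit Types f g h : fps R.

Definition fps_zero : fps R := Fps (fun _ => 0).
Definition fps_opp f : fps R := Fps (fun n => - f n).
Definition fps_add f g : fps R := Fps (fun n => f n + g n).
Definition fps_one : fps R := Fps (fun n => (n == 0)%:R).
Definition fps_mul f g : fps R := Fps (fun n => \sum_(i < n.+1) f i * g (n - i)%N).

Fact fps_addA : associative fps_add.
Proof. by move=> f g h; apply/fpsP => n /=; rewrite addrA. Qed.
Fact fps_addC : commutative fps_add.
Proof. by move=> f g; apply/fpsP => n /=; rewrite addrC. Qed.
Fact fps_add0 : left_id fps_zero fps_add.
Proof. by move=> f; apply/fpsP => n /=; rewrite add0r. Qed.
Fact fps_addN : left_inverse fps_zero fps_opp fps_add.
Proof. by move=> f; apply/fpsP => n /=; rewrite addNr. Qed.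

HB.instance Definition _ :=
  GRing.isZmodule.Build (fps R) fps_addA fps_addC fps_add0 fps_addN.

Let trunc N f : {poly R} := \poly_(i < N) f i.

Let fps_mulE f g n N : (n < N)%N -> fps_mul f g n = (trunc N f * trunc N g)`_n.
Proof.
move=> nN; rewrite /= coefM; apply: eq_bigr => i _.
rewrite !coef_poly (leq_ltn_trans (leq_ord i) nN).
by rewrite (leq_ltn_trans (leq_subr i n) nN).
Qed.

Fact fps_mulA : associative fps_mul.
Proof.
move=> f g h; apply/fpsP => n.
transitivity ((trunc n.+1 f * (trunc n.+1 g * trunc n.+1 h))`_n).
  rewrite coefM; apply: eq_bigr => i _; rewrite coef_poly ltn_ord.
  by rewrite -fps_mulE // ltnS leq_subr.
rewrite mulrA coefM; apply: eq_bigr => i _.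
rewrite -fps_mulE ?ltn_ord // coef_poly ltnS leq_subr.
by [].
Qed.

Fact fps_mulC : commutative fps_mul.
Proof. by move=> f g; apply/fpsP => n; rewrite !(@fps_mulE _ _ n n.+1) // mulrC. Qed.

Fact fps_mul1 : left_id fps_one fps_mul.
Proof.
move=> f; apply/fpsP => n /=; rewrite big_ord_recl /= mul1r subn0 big1 ?addr0 //.
by move=> i _; rewrite /= mul0r.
Qed.

Fact fps_mulD : left_distributive fps_mul fps_add.
Proof.
move=> f g h; apply/fpsP => n /=; rewrite -big_split /=.
by apply: eq_bigr => i _; rewrite mulrDl.
Qed.

Fact fps_1neq0 : fps_one != fps_zero.
Proof. by apply/eqP => /fpsP/(_ 0%N)/eqP; rewrite /= oner_eq0. Qed.

HB.instance Definition _ := GRing.Zmodule_isComNzRing.Build (fps R)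
  fps_mulA fps_mulC fps_mul1 fps_mulD fps_1neq0.

Lemma coefq0 n : (0 : fps R) n = 0. Proof. by []. Qed.
Lemma coefq1 n : (1 : fps R) n = (n == 0)%:R. Proof. by []. Qed.
Lemma coefqN f n : (- f) n = - f n. Proof. by []. Qed.
Lemma coefqD f g n : (f + g) n = f n + g n. Proof. by []. Qed.
Lemma coefqB f g n : (f - g) n = f n - g n. Proof. by []. Qed.
Lemma coefqM f g n : (f * g) n = \sum_(i < n.+1) f i * g (n - i)%N.
Proof. by []. Qed.

Lemma coefq_sum (I : Type) (r : seq I) (P : pred I) (F : I -> fps R) n :
  (\sum_(i <- r | P i) F i) n = \sum_(i <- r | P i) F i n.
Proof. by elim/big_rec2: _ => // i x y _ <-. Qed.

Definition fpsC (a : R) : fps R := Fps (fun n => if n == 0%N then a else 0).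
Definition fpsX : fps R := Fps (fun n => (n == 1)%:R).

Lemma coefqCM a f n : (fpsC a * f) n = a * f n.
Proof.
rewrite coefqM big_ord_recl /= subn0 big1 ?addr0 //.
by move=> i _; rewrite /= mul0r.
Qed.

Lemma coefqXM f n : (fpsX * f) n = if n is k.+1 then f k else 0.
Proof.
rewrite coefqM; case: n => [|n]; first by rewrite big_ord1 /= mul0r.
rewrite big_ord_recl /= mul0r add0r big_ord_recl /= mul1r subSS subn0.
by rewrite big1 ?addr0 // => i _; rewrite /= mul0r.
Qed.

Lemma coefqXnM k f n : (fpsX ^+ k * f) n = if (n < k)%N then 0 else f (n - k)%N.
Proof.
elim: k n => [|k IH] n; first by rewrite expr0 mul1r subn0.
by rewrite exprS -mulrA coefqXM; case: n => [|n] //; rewrite IH subSS ltnS.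
Qed.

Lemma coefq_exp_small h k n : h 0%N = 0 -> (n < k)%N -> (h ^+ k) n = 0.
Proof.
move=> h0; elim: k n => [//|k IH] n nk; rewrite exprS coefqM big_ord_recl /= h0.
rewrite mul0r add0r big1 // => i _; rewrite IH ?mulr0 //.
case: n nk i => [|n] nk i; first by case: i.
by rewrite /= /bump leq0n add1n subSS (leq_ltn_trans (leq_subr _ _)).
Qed.

End Ring.

Section UnitRing.
Variable R : comUnitRingType.
Implicit Types f g h : fps R.

Definition fps_unit : {pred fps R} := [pred f : fps R | f 0%N \is a GRing.unit].

(* With c = 1 / f(0): 1/f = c * sum_k (1 - c f)^k, a geometric series whose
   terms with k > n do not contribute to the coefficient of q^n. *)
Definition fps_geom h : fps R := Fps (fun n => (\sum_(k < n.+1) h ^+ k) n).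
Definition fps_inv f : fps R :=
  if f 0%N \is a GRing.unit
  then fpsC (f 0%N)^-1 * fps_geom (1 - fpsC (f 0%N)^-1 * f) else f.

Lemma fps_geomE h n N : h 0%N = 0 -> (n <= N)%N ->
  fps_geom h n = (\sum_(k < N.+1) h ^+ k) n.
Proof.
move=> h0 nN; rewrite /= !coefq_sum.
rewrite (big_ord_widen N.+1 (fun k => (h ^+ k) n)) ?ltnS //.
rewrite [RHS](bigID (fun k : 'I_N.+1 => (k < n.+1)%N)) /=.
rewrite [X in _ = _ + X]big1 ?addr0 // => k; rewrite -leqNgt => nk.
exact: coefq_exp_small.
Qed.

Lemma fps_geomP h : h 0%N = 0 -> (1 - h) * fps_geom h = 1.
Proof.
move=> h0; apply/fpsP => n.
have -> : ((1 - h) * fps_geom h) n = ((1 - h) * \sum_(k < n.+1) h ^+ k) n.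
  rewrite !coefqM; apply: eq_bigr => i _.
  by rewrite (@fps_geomE h _ n) // leq_subr.
by rewrite -opprB mulNr -subrX1 opprB coefqB (coefq_exp_small h0) ?subr0.
Qed.

Fact fps_mulVf : {in fps_unit, left_inverse 1 fps_inv *%R}.
Proof.
move=> f; rewrite inE => uf; rewrite /fps_inv uf mulrAC.
set h := 1 - _; have -> : fpsC (f 0%N)^-1 * f = 1 - h by rewrite /h subKr.
by apply: fps_geomP; rewrite /h coefqB coefqCM mulVr // coefq1 subrr.
Qed.

Fact fps_unitP f g : g * f = 1 -> f \in fps_unit.
Proof.
move=> /fpsP/(_ 0%N); rewrite coefqM big_ord1 coefq1 subnn /= => gf.
by rewrite inE; apply/unitrPr; exists (g 0%N); rewrite mulrC.
Qed.

Fact fps_inv_out : {in [predC fps_unit], fps_inv =1 id}.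
Proof. by move=> f; rewrite !inE => /negPf uf; rewrite /fps_inv uf. Qed.

HB.instance Definition _ := GRing.ComNzRing_hasMulInverse.Build (fps R)
  fps_mulVf fps_unitP fps_inv_out.

Lemma unit_fpsE f : (f \is a GRing.unit) = (f 0%N \is a GRing.unit).
Proof. by []. Qed.

End UnitRing.

Notation "''q'" := (fpsX _) (at level 0) : ring_scope.

(* The sum of a summable family of power series, coefficient by coefficient
   (for each n only finitely many members have a nonzero coefficient of q^n). *)
Definition fps_sum (R : comNzRingType) (D : set nat) (F : nat -> fps R) : fps R :=
  Fps (fun n => \sum_(k \in D) F k n).

Lemma fps_sumE (R : comNzRingType) (F : nat -> fps R) n :
  (forall k, (n < k)%N -> F k n = 0) ->
  fps_sum [set k | (0 < k)%N] F n = \sum_(1 <= k < n.+1) F k n.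
Proof.
move=> F0; rewrite /= (@fsbigE _ _ _ _ _ (index_iota 1 n.+1)) ?iota_uniq //=.
- rewrite big_seq_cond [RHS]big_seq_cond; apply: eq_bigl => k.
  rewrite mem_index_iota; case: (ltnP 0 k) => k0 //=.
  by rewrite mem_set // andbT.
- by move=> k /=; rewrite mem_index_iota => /andP[].
- move=> k /= k0; rewrite mem_index_iota k0 /= -leqNgt; exact: F0.
Qed.

Definition qpoch (R : comNzRingType) (a : fps R) (n : nat) : fps R :=
  \prod_(k < n) (1 - a * 'q ^+ k).

Lemma qpochS (R : comNzRingType) (a : fps R) n :
  qpoch a n.+1 = qpoch a n * (1 - a * 'q ^+ n).
Proof. by rewrite /qpoch big_ord_recr. Qed.

(* The factors 1 - a q^k with k > n do not affect the coefficient of q^n. *)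
Definition qpochoo (R : comNzRingType) (a : fps R) : fps R :=
  Fps (fun n => qpoch a n.+1 n).

Lemma qpochooE (R : comNzRingType) (a : fps R) n N :
  (n < N)%N -> qpoch a N n = qpochoo a n.
Proof.
move=> /subnK <-; elim: (N - n.+1)%N => [|m IH]; first by rewrite add0n.
rewrite addSn qpochS mulrBr mulr1 coefqB IH.
by rewrite mulrA mulrC coefqXnM ltn_addl // subr0.
Qed.

Definition spt_minus_term (n1 n2 : nat) : fps int :=
  'q ^+ (n1 * n2 + n2) / ((1 - 'q ^+ n2) ^+ 2 * qpoch ('q ^+ n2.+1) n1).

Definition spt_minus_gf : fps int :=
  fps_sum [set n1 | (0 < n1)%N] (fun n1 =>
    'q ^+ n1 / ((1 - 'q ^+ n1) ^+ 2 * qpochoo ('q ^+ n1.+1))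
    * fps_sum [set n2 | (0 < n2)%N] (fun n2 => spt_minus_term n1 n2)).

Definition spt_minus (n : nat) : int := spt_minus_gf n.

(* Both families above are summable, so that no coefficient falls back on the
   default value of sums over a set with infinite support. *)
Lemma spt_minusE n : spt_minus n = \sum_(1 <= n1 < n.+1)
  ('q ^+ n1 / ((1 - 'q ^+ n1) ^+ 2 * qpochoo ('q ^+ n1.+1))
   * \sum_(1 <= n2 < n.+1) spt_minus_term n1 n2) n.
Proof.
rewrite /spt_minus /spt_minus_gf fps_sumE; last first.
  by move=> k nk; rewrite -!mulrA coefqXnM nk.
apply: eq_bigr => n1 _; rewrite !coefqM; apply: eq_bigr => i _; congr (_ * _).
set j := (n - i)%N; rewrite fps_sumE; last first.
  by move=> k jk; rewrite coefqXnM (leq_trans jk) ?leq_addl.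
rewrite coefq_sum (@big_cat_nat _ _ _ j.+1 1 n.+1) //.
  rewrite -[LHS]addr0; congr (_ + _); rewrite big_nat_cond big1 // => k.
  move=> /andP[/andP[jk _] _].
  by rewrite /spt_minus_term coefqXnM (leq_trans jk) ?leq_addl.
by rewrite ltnS leq_subr.
Qed.

(* Partitions of n as nonincreasing sequences of parts padded with zeros to
   length n. *)
Definition npartitions (n : nat) : nat :=
  #|[pred t : n.-tuple 'I_n.+1 |
      sorted geq (map val t) && (sumn (map val t) == n)]|.

Definition crank_gf (R : comUnitRingType) (z w : R) : fps R :=
  qpochoo 'q / (qpochoo (fpsC z * 'q) * qpochoo (fpsC w * 'q)).

(* The coefficients of the crank generating function are Laurent polynomials
   in z; they are computed with independent variables z = 'X%:P and w = 'X, and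
   w = 1/z is substituted by collecting the monomials z^a w^b with a - b = m.
   The bounds a, b <= n lose nothing: see crank_genfun. *)
Definition crank (m : int) (n : nat) : int :=
  \sum_(a < n.+1) \sum_(b < n.+1 | a%:Z - b%:Z == m)
    (crank_gf ('X%:P : {poly {poly int}}) 'X n)`_b`_a.

Definition crank_moment (k n : nat) : int :=
  \sum_(m \in [set: int]) m ^+ k * crank m n.

Definition binz4 (x : int) : rat :=
  (x * (x - 1) * (x - 2) * (x - 3))%:~R / 24.

(* Summation over j = i - n from -n to n *)
Definition mu4 (n : nat) : rat :=
  \sum_(i < n.*2.+1) binz4 (i%:Z - n%:Z + 1) * (crank (i%:Z - n%:Z) n)%:~R.

Lemma crank_eq0 (m : int) (n : nat) : (n < `|m|)%N -> crank m n = 0.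
Proof.
move=> nm; rewrite /crank big1 // => a _; rewrite big1 // => b /eqP abm.
by move: nm (ltn_ord a) (ltn_ord b); lia.
Qed.

Lemma crank_sumE (V : nmodType) (F : int -> V) n :
  (forall m, (n < `|m|)%N -> F m = 0) ->
  \sum_(m \in [set: int]) F m = \sum_(i < n.*2.+1) F (i%:Z - n%:Z).
Proof.
move=> F0.
rewrite (@fsbigE _ _ _ _ _ [seq i%:Z - n%:Z | i <- index_iota 0 n.*2.+1]) //.
- rewrite big_map big_mkord; apply: eq_bigl => i; exact: mem_set.
- by rewrite map_inj_uniq ?iota_uniq // => i j /addIr[].
- move=> m _ mr; apply: F0; rewrite ltnNge; apply: contra mr => mn.
  apply/mapP; exists (absz (m + n%:Z)); last by lia.
  by rewrite mem_index_iota; lia.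
Qed.

Lemma crank_momentE (k n : nat) : crank_moment k n =
  \sum_(i < n.*2.+1) (i%:Z - n%:Z) ^+ k * crank (i%:Z - n%:Z) n.
Proof.
rewrite /crank_moment (@crank_sumE _ _ n) // => m nm.
by rewrite crank_eq0 ?mulr0.
Qed.

Section Map.
Variables (R S : comNzRingType) (phi : {rmorphism R -> S}).
Definition map_fps (f : fps R) : fps S := Fps (fun n => phi (f n)).
Fact map_fps_zmod : zmod_morphism map_fps.
Proof. by move=> f g; apply/fpsP => n; rewrite /= rmorphD rmorphN. Qed.
Fact map_fps_monoid : monoid_morphism map_fps.
Proof.
split=> [|f g]; apply/fpsP => n; rewrite /= ?rmorph_nat // rmorph_sum.
by apply: eq_bigr => i _; rewrite rmorphM.
Qed.
HB.instance Definition _ := GRing.isZmodMorphism.Build _ _ map_fps map_fps_zmod.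
HB.instance Definition _ :=
  GRing.isMonoidMorphism.Build _ _ map_fps map_fps_monoid.
End Map.

Lemma map_fpsX (R S : comNzRingType) (phi : {rmorphism R -> S}) :
  map_fps phi 'q = 'q.
Proof. by apply/fpsP => n; rewrite /= rmorph_nat. Qed.

Lemma map_fpsC (R S : comNzRingType) (phi : {rmorphism R -> S}) (a : R) :
  map_fps phi (fpsC a) = fpsC (phi a).
Proof. by apply/fpsP => n; rewrite /=; case: ifP; rewrite ?rmorph0. Qed.

Lemma map_qpoch (R S : comNzRingType) (phi : {rmorphism R -> S}) (a : fps R) n :
  map_fps phi (qpoch a n) = qpoch (map_fps phi a) n.
Proof.
rewrite /qpoch rmorph_prod; apply: eq_bigr => k _.
by rewrite rmorphB rmorph1 rmorphM rmorphXn /= map_fpsX.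
Qed.

Lemma map_qpochoo (R S : comNzRingType) (phi : {rmorphism R -> S}) (a : fps R) :
  map_fps phi (qpochoo a) = qpochoo (map_fps phi a).
Proof.
by apply/fpsP => n; rewrite -(qpochooE _ (ltnSn n)) -map_qpoch.
Qed.

Lemma qpochoo0 (R : comNzRingType) (a : fps R) : a 0%N = 0 -> qpochoo a 0%N = 1.
Proof.
move=> a0; rewrite -(@qpochooE _ a 0 1) // qpochS /qpoch big_ord0 mul1r expr0.
by rewrite mulr1 coefqB a0 subr0.
Qed.

Lemma crank_gf_den0 (R : comUnitRingType) (z w : R) :
  (qpochoo (fpsC z * 'q) * qpochoo (fpsC w * 'q)) 0%N = 1.
Proof. by rewrite coefqM big_ord1 !qpochoo0 ?mulr1 // coefqCM mulr0. Qed.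

Lemma map_crank_gf (R S : comUnitRingType) (phi : {rmorphism R -> S}) z w :
  map_fps phi (crank_gf z w) = crank_gf (phi z) (phi w).
Proof.
rewrite /crank_gf rmorphM rmorphV ?unit_fpsE ?crank_gf_den0 ?unitr1 //.
by rewrite rmorphM /= !map_qpochoo !rmorphM /= !map_fpsC !map_fpsX.
Qed.

Section Grading.
Local Notation L := {poly {poly int}}.
Local Notation dle n p :=
  (forall a b, (n < a)%N || (n < b)%N -> (p : L)`_b`_a = 0).
Definition graded (f : fps L) := forall n, dle n (f n).

Lemma gradedD f g : graded f -> graded g -> graded (f + g).
Proof. by move=> Gf Gg n a b ab; rewrite coefqD !coefD Gf ?Gg ?addr0. Qed.
Lemma gradedN f : graded f -> graded (- f).
Proof. by move=> Gf n a b ab; rewrite coefqN !coefN Gf ?oppr0. Qed.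
Lemma graded1 : graded 1.
Proof.
case=> [|n] a b ab; rewrite coefq1 ?coef0 ?coef0 // coef1.
by case: b ab => [|b] /=; rewrite ?coef0 // orbF coef1; case: a.
Qed.

Lemma gradedM f g : graded f -> graded g -> graded (f * g).
Proof.
move=> Gf Gg n a b ab; rewrite coefqM !coef_sum big1 // => i _.
rewrite coefM coef_sum big1 // => j _; rewrite coefM big1 // => k _.
have := ltn_ord i; have := ltn_ord j; have := ltn_ord k => ka jb ni.
have [ij|] := boolP ((i < k)%N || (i < j)%N); first by rewrite Gf ?mul0r.
rewrite negb_or -!leqNgt => /andP[ki ji]; rewrite [X in _ * X]Gg ?mulr0 //.
by case/orP: ab => ab; apply/orP; [left|right]; lia.
Qed.

Lemma gradedX f k : graded f -> graded (f ^+ k).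
Proof.
by move=> Gf; elim: k => [|k IH]; [exact: graded1 | rewrite exprS; exact: gradedM].
Qed.

Lemma graded_geom h : graded h -> graded (fps_geom h).
Proof.
move=> Gh n a b ab; rewrite /fps_geom [coefq _ _]/= coefq_sum !coef_sum big1 //.
by move=> k _; exact: gradedX.
Qed.

Lemma gradedq : graded 'q.
Proof.
move=> n a b; rewrite /=; case: n => [|[|n]] ab; rewrite ?coef0 ?coef0 //.
by rewrite coef1; case: b ab => [|b] /=; rewrite ?coef0 // orbF coef1; case: a.
Qed.

Lemma gradedCq c : dle 1%N c -> graded (fpsC c * 'q).
Proof.
move=> Gc n a b; rewrite coefqCM /=; case: n => [|[|n]] ab;
  rewrite ?mulr0 ?mulr1 ?coef0 ?coef0 //; exact: Gc.
Qed.

Lemma graded_qpochoo f : graded f -> graded (qpochoo f).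
Proof.
move=> Gf n; rewrite -(@qpochooE _ _ n n.+1) //; move: n.
suff G N : graded (qpoch f N) by move=> n; exact: G.
elim: N => [|N IH]; first by rewrite /qpoch big_ord0; exact: graded1.
rewrite qpochS; apply: gradedM => //; apply: gradedD; first exact: graded1.
by apply/gradedN/gradedM/gradedX/gradedq.
Qed.

Lemma graded_crank : graded (crank_gf 'X%:P 'X).
Proof.
have Gq := graded_qpochoo gradedq.
have Gu : graded (qpochoo (fpsC 'X%:P * 'q)).
  apply/graded_qpochoo/gradedCq => a b; rewrite coefC.
  by case: b => [|b] /=; rewrite ?coef0 // orbF coefX; case: a => [|[]].
have Gv : graded (qpochoo (fpsC 'X * 'q)).
  apply/graded_qpochoo/gradedCq => a b; rewrite coefX.
  by case: b => [|[|b]] /=; rewrite ?coef0 // orbF coef1; case: a.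
apply: gradedM => //.
have -> (f : fps L) : f 0%N = 1 -> f^-1 = fps_geom (1 - f).
  move=> f0; have uf : f \is a GRing.unit by rewrite unit_fpsE f0 unitr1.
  apply: (mulrI uf); rewrite divrr //; apply/esym.
  rewrite -{1}[f](subKr 1); apply: fps_geomP.
  by rewrite coefqB f0 subrr.
  by apply/graded_geom/gradedD/gradedN/gradedM => //; exact: graded1.
exact: crank_gf_den0.
Qed.
End Grading.

(* The generating function of the crank, with the Laurent polynomial in z
   evaluated at an arbitrary unit of an arbitrary commutative ring. *)
Theorem crank_genfun (R : comUnitRingType) (z : R) (n : nat) :
  z \is a GRing.unit ->
  crank_gf z z^-1 n = \sum_(m \in [set: int]) (crank m n)%:~R * z ^ m.
Proof.
move=> uz.
pose ev : {rmorphism {poly int} -> R} := horner_eval z \o map_poly intr.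
pose phi : {rmorphism {poly {poly int}} -> R} := horner_eval z^-1 \o map_poly ev.
have phiu : phi 'X%:P = z by rewrite /= map_polyC /= /horner_eval hornerC map_polyX hornerX.
have phiv : phi 'X = z^-1 by rewrite /= map_polyX /horner_eval hornerX.
have := map_crank_gf phi 'X%:P 'X; rewrite phiu phiv => <-.
have -> : map_fps phi (crank_gf 'X%:P 'X) n = phi (crank_gf 'X%:P 'X n) by [].
have Gc := @graded_crank n.
set c := (crank_gf _ _ n) in Gc *.
have sc : (size c <= n.+1)%N.
  apply/leq_sizeP => b nb; apply/polyP => a; rewrite coef0.
  by apply: Gc; apply/orP; right.
have sc' b : (size (c`_b)%R <= n.+1)%N.
  by apply/leq_sizeP => a na; apply: Gc; apply/orP; left.
have -> : phi c = \sum_(a < n.+1) \sum_(b < n.+1) (c`_b`_a)%:~R * z ^ (a%:Z - b%:Z).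
  rewrite exchange_big [LHS](_ : _ = (map_poly ev c).[z^-1]) //.
  rewrite (@horner_coef_wide _ n.+1); last first.
    exact: leq_trans (size_poly _ _) sc.
  apply: eq_bigr => b _; have -> : (map_poly ev c)`_b = (map_poly intr (c`_b)%R).[z] by rewrite coef_map.
  rewrite (@horner_coef_wide _ n.+1); last first.
    exact: leq_trans (size_poly _ _) (sc' b).
  rewrite mulr_suml; apply: eq_bigr => a _; rewrite coef_map /= -mulrA.
  by rewrite exprzDr // -exprnN exprVn.
rewrite (@crank_sumE _ _ n); last by move=> m nm; rewrite crank_eq0 // mul0r.
pose r := [seq i%:Z - n%:Z | i <- index_iota 0 n.*2.+1].
rewrite -(big_mkord xpredT
  (fun i => (crank (i%:Z - n%:Z) n)%:~R * z ^ (i%:Z - n%:Z))).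
rewrite -(big_map (fun i : nat => i%:Z - n%:Z) xpredT
  (fun m => (crank m n)%:~R * z ^ m)) -/r.
have ur : uniq r by rewrite map_inj_uniq ?iota_uniq // => i j /addIr[].
transitivity (\sum_(m <- r) \sum_(a < n.+1) \sum_(b < n.+1)
    (if a%:Z - b%:Z == m then (c`_b`_a)%:~R * z ^ m else 0)); last first.
  apply: eq_bigr => m _; rewrite /crank rmorph_sum mulr_suml.
  apply: eq_bigr => a _; rewrite rmorph_sum mulr_suml [RHS]big_mkcond.
  exact: eq_bigr.
rewrite [RHS]exchange_big; apply: eq_bigr => a _.
rewrite [RHS]exchange_big; apply: eq_bigr => b _ /=.
rewrite (bigD1_seq (a%:Z - b%:Z)) //=.
  rewrite eqxx big1 ?addr0 // => m; rewrite eq_sym => /negPf -> //.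
apply/mapP; exists (n + a - b)%N.
  by rewrite mem_index_iota; move: (ltn_ord a) (ltn_ord b); lia.
by move: (ltn_ord a) (ltn_ord b); lia.
Qed.

(* Main.v *)
Require Import Defs.
From mathcomp Require Import all_boot all_order all_algebra.
From mathcomp Require Import zify ring.

(* Put x_k = q^k/(1-q^k)^2, and let e_2, h_1, h_2 be the elementary and
   complete symmetric functions of x_1, x_2, ...  All generating functions
   involved are 1/(q;q)_oo times a polynomial in such sums.
   - SPT^-: the double sum is sum_{m,n} x_m x_n C(m,n), where
     C(m,n) = q^{mn} (q)_m (q)_n / (q)_{m+n} is the connector of Seki and
     Yamamoto's connected sum method; moving the factor q^m/(1-q^m) of x_m
     through C turns the double sum into e_2.
   - Cranks: (1 - z q^k)(1 - q^k/z) = (1 - q^k)^2 (1 - (z - 2 + 1/z) x_k), so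
     expanding at z = 1 + u gives mu_4 = h_2 and M_4 = 24 h_2 + 2 h_1.
   - Partitions: by logarithmic differentiation n p(n) and n^2 p(n) correspond
     to h_1 and h_1^2 + sum_k k y_k, with y_k = q^k (1+q^k)/(1-q^k)^3.
   The theorem is then Ramanujan's differential equation for E_2, in the form
   2 h_1^2 = 5 sum_k x_k^2 + h_1 - sum_k k y_k.  With l(a) = a/(1-a), it follows
   from the partial fractions l(a) l(b) = l(ab) (1 + l(a) + l(b)): apply
   (a d/da) (b d/db) resp. (a d/da)^2 and sum over a = q^m, b = q^k.
   All identities hold modulo q^(N+1), with sums and products cut at N. *)

Set Implicit Arguments.
Unset Strict Implicit.
Unset Printing Implicit Defensive.
Import GRing.Theory.
Local Open Scope ring_scope.

(** * Congruences modulo q^(N+1) *)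

Section Congruence.
Variables (R : comUnitRingType) (N : nat).
Implicit Types f g h : fps R.

Definition eqq f g := forall n, (n <= N)%N -> f n = g n.

Lemma eqq_refl f : eqq f f. Proof. by []. Qed.
Lemma eqq_sym f g : eqq f g -> eqq g f.
Proof. by move=> fg n nN; rewrite fg. Qed.
Lemma eqq_trans g f h : eqq f g -> eqq g h -> eqq f h.
Proof. by move=> fg gh n nN; rewrite fg // gh. Qed.

Lemma eqqD f1 f2 g1 g2 : eqq f1 g1 -> eqq f2 g2 -> eqq (f1 + f2) (g1 + g2).
Proof. by move=> e1 e2 n nN; rewrite !coefqD e1 // e2. Qed.

Lemma eqqB f1 f2 g1 g2 : eqq f1 g1 -> eqq f2 g2 -> eqq (f1 - f2) (g1 - g2).
Proof. by move=> e1 e2 n nN; rewrite !coefqB e1 // e2. Qed.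

Lemma eqqM f1 f2 g1 g2 : eqq f1 g1 -> eqq f2 g2 -> eqq (f1 * f2) (g1 * g2).
Proof.
move=> e1 e2 n nN; rewrite !coefqM; apply: eq_bigr => i _.
by rewrite e1 ?e2 //; have := ltn_ord i; lia.
Qed.

Lemma eqqMl h f g : eqq f g -> eqq (h * f) (h * g).
Proof. by move=> fg; apply: eqqM. Qed.

(** The difference of the inverses is [f^-1 * g^-1 * (g - f)]. *)
Lemma eqqV f g : f \is a GRing.unit -> g \is a GRing.unit ->
  eqq f g -> eqq f^-1 g^-1.
Proof.
move=> uf ug fg.
have := eqqMl (f^-1 * g^-1) (eqq_sym fg).
by rewrite mulrVK // mulrAC mulVr // mul1r.
Qed.

Lemma eqq_sum (I : eqType) (r : seq I) (F G : I -> fps R) :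
  {in r, forall i, eqq (F i) (G i)} -> eqq (\sum_(i <- r) F i) (\sum_(i <- r) G i).
Proof.
move=> FG n nN; rewrite !coefq_sum [LHS]big_seq [RHS]big_seq.
by apply: eq_bigr => i ri; apply: FG.
Qed.

Lemma eqq_sum0 (I : eqType) (r : seq I) (F : I -> fps R) :
  {in r, forall i, eqq (F i) 0} -> eqq (\sum_(i <- r) F i) 0.
Proof.
by move=> F0 n nN; rewrite coefq_sum big_seq big1 // => i ri; rewrite F0.
Qed.

Lemma eqq_subl h f : eqq h 0 -> eqq (f - h) f.
Proof. by move=> h0 n nN; rewrite coefqB h0 // subr0. Qed.

Lemma eqqMX0 k f : (N < k)%N -> eqq ('q ^+ k * f) 0.
Proof. by move=> Nk n nN; rewrite coefqXnM (leq_ltn_trans nN Nk). Qed.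

End Congruence.

(** * Lambert series and Ramanujan's equation *)

Section Series.
Variable R : comUnitRingType.
Implicit Types (f g : fps R) (k m n : nat).

Lemma unit_1subX k : (0 < k)%N -> (1 - 'q ^+ k : fps R) \is a GRing.unit.
Proof.
by case: k => // k _; rewrite unit_fpsE coefqB exprS coefqXM subr0 coefq1 unitr1.
Qed.

(* [lambert], [dlambert] and [ddlambert] are the values at [a = q^k] of
   [l = a/(1-a)], [a l'] and [a (a l')'], as polynomials in [l]. *)
Definition lambert k : fps R := 'q ^+ k / (1 - 'q ^+ k).
Definition dlambert k : fps R := lambert k * (1 + lambert k).
Definition ddlambert k : fps R := dlambert k * (1 + 2 * lambert k).
(** Generating function of the partitions into parts at most [n]; it agrees with 1/(q;q)_oo modulo
    q^(n+1). *)
Definition partgf n : fps R := (qpoch 'q n)^-1.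

Lemma add1_lambert k : (0 < k)%N -> 1 + lambert k = (1 - 'q ^+ k)^-1.
Proof.
move=> k0; apply: (mulIr (unit_1subX k0)).
by rewrite mulrDl mulVr ?unit_1subX // mulrVK ?unit_1subX //; ring.
Qed.

Lemma dlambertE k : (0 < k)%N -> dlambert k = 'q ^+ k / (1 - 'q ^+ k) ^+ 2.
Proof. by move=> k0; rewrite /dlambert add1_lambert // /lambert -mulrA -expr2 exprVn. Qed.

Lemma coefqX0 k : (0 < k)%N -> ('q ^+ k : fps R) 0%N = 0.
Proof. by case: k => // k _; rewrite exprS coefqXM. Qed.

(** After clearing denominators this is 1 - ab = (1-a)(1-b) + a(1-b) + b(1-a) with a = q^m, b =
    q^n. *)
Lemma lambert_mul m n : (0 < m)%N -> (0 < n)%N ->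
  lambert m * lambert n = lambert (m + n) * (1 + lambert m + lambert n).
Proof.
move=> m0 n0; have um := unit_1subX m0; have un := unit_1subX n0.
have mn0 : (0 < m + n)%N by rewrite addn_gt0 m0.
have umn := unit_1subX mn0.
apply: (mulIr um); apply: (mulIr un); apply: (mulIr umn).
have e k : (0 < k)%N -> lambert k * (1 - 'q ^+ k) = 'q ^+ k.
  by move=> k0; rewrite /lambert mulrVK ?unit_1subX.
transitivity ((lambert m * (1 - 'q ^+ m)) * (lambert n * (1 - 'q ^+ n)) * (1 - 'q ^+ (m + n))).
  by ring.
transitivity ((lambert (m + n) * (1 - 'q ^+ (m + n))) *
   ((1 - 'q ^+ m) * (1 - 'q ^+ n) + (lambert m * (1 - 'q ^+ m)) * (1 - 'q ^+ n)
    + (lambert n * (1 - 'q ^+ n)) * (1 - 'q ^+ m))).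
  by rewrite !e // exprD; ring.
by ring.
Qed.

Lemma dlambert_mul m n : (0 < m)%N -> (0 < n)%N ->
  dlambert m * dlambert n = ddlambert (m + n) * (1 + lambert m + lambert n)
  + dlambert (m + n) * (dlambert m + dlambert n).
Proof.
move=> m0 n0; have /eqP := lambert_mul m0 n0; rewrite -subr_eq0 => /eqP e.
apply/eqP; rewrite -subr_eq0; apply/eqP; rewrite /ddlambert /dlambert.
set a := lambert m in e *; set b := lambert n in e *; set g := lambert (m + n) in e *.
(* The derivations in a and b do not act on values at powers of q. Instead, the differentiated
   relation is checked to be a polynomial multiple of [e]. *)
have -> : a * (1 + a) * (b * (1 + b)) - (g * (1 + g) * (1 + 2 * g) * (1 + a + b)
  + g * (1 + g) * (a * (1 + a) + b * (1 + b))) =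
  (a * b - g * (1 + a + b)) * (1 + a + b + a * b + g * (1 + a + b) + 2 * (g + g ^+ 2)).
  by ring.
by rewrite e mul0r.
Qed.

Lemma ddlambert_lambert_mul m n : (0 < m)%N -> (0 < n)%N ->
  ddlambert m * lambert n = ddlambert (m + n) * (1 + lambert m + lambert n)
                 + 2 * (dlambert (m + n) * dlambert m)
                 + lambert (m + n) * ddlambert m.
Proof.
move=> m0 n0; have /eqP := lambert_mul m0 n0; rewrite -subr_eq0 => /eqP e.
apply/eqP; rewrite -subr_eq0; apply/eqP; rewrite /ddlambert /dlambert.
set a := lambert m in e *; set b := lambert n in e *; set g := lambert (m + n) in e *.
transitivity ((a * b - g * (1 + a + b)) *
   ((1 + a + g) ^+ 2 + a + a ^+ 2 + g + g ^+ 2)); first by ring.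
by rewrite e mul0r.
Qed.
End Series.

Arguments lambert {R} k.
Arguments dlambert {R} k.
Arguments ddlambert {R} k.
Arguments partgf {R} n.

(** * Finite double sums and convolutions *)

Section Sums.
Variable R : comPzRingType.
Implicit Types (a b : nat -> R) (F : nat -> nat -> R).

Lemma exchange_triangle F N :
  \sum_(1 <= n < N.+1) \sum_(1 <= m < n) F m n =
  \sum_(1 <= m < N.+1) \sum_(m.+1 <= n < N.+1) F m n.
Proof.
elim: N => [|N IH]; first by rewrite !big_geq.
rewrite [LHS]big_nat_recr //= IH [RHS]big_nat_recr //= [X in _ = _ + X]big_geq //.
rewrite addr0 -big_split /=; apply: eq_big_nat => m /andP[m0 mN].
by rewrite [RHS] big_nat_recr.
Qed.

Lemma mul_sum_diag a b N :
  (\sum_(1 <= n < N.+1) a n) * (\sum_(1 <= n < N.+1) b n) =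
  \sum_(1 <= n < N.+1) a n * b n
  + \sum_(1 <= n < N.+1) a n * \sum_(1 <= m < n) b m
  + \sum_(1 <= n < N.+1) b n * \sum_(1 <= m < n) a m.
Proof.
elim: N => [|N IH]; first by rewrite !big_geq //; ring.
rewrite !(@big_nat_recr _ _ _ N.+1) //= mulrDl !mulrDr IH; ring.
Qed.

Lemma sum_rev a n : \sum_(1 <= m < n) a (n - m)%N = \sum_(1 <= m < n) a m.
Proof.
rewrite [RHS]big_nat_rev /=; apply: eq_big_nat => m /andP[m0 mn].
by congr a; lia.
Qed.
End Sums.

Section Convolution.
Variable R : comUnitRingType.

(** Products with m + k > N are divisible by q^(N+1), so the square of indices may be cut to the
    triangle m + k <= N and regrouped by n = m + k. *)
Lemma eqq_convolution (a b : nat -> fps R) N :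
  (forall k, exists h, a k = 'q ^+ k * h) ->
  (forall k, exists h, b k = 'q ^+ k * h) ->
  eqq N ((\sum_(1 <= m < N.+1) a m) * (\sum_(1 <= k < N.+1) b k))
    (\sum_(1 <= n < N.+1) \sum_(1 <= m < n) a m * b (n - m)%N).
Proof.
move=> Ha Hb; rewrite (exchange_triangle (fun m n => a m * b (n - m)%N)).
rewrite mulr_suml; apply: eqq_sum => m; rewrite mem_index_iota => /andP[m0 mN].
rewrite mulr_sumr (@big_cat_nat _ _ _ (N - m).+1 1 N.+1) //=; last by lia.
rewrite -[X in eqq _ _ X]addr0; apply: eqqD.
  rewrite -(add1n m) big_addn subSn //.
  by under [X in eqq _ _ X]eq_bigr do rewrite addnK.
apply: eqq_sum0 => k; rewrite mem_index_iota => /andP[k0 kN].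
have [h ->] := Ha m; have [h' ->] := Hb k.
rewrite mulrACA -exprD; apply: eqqMX0; lia.
Qed.
End Convolution.

(** * Two convolution identities and Ramanujan's equation *)

Section Ramanujan.
Variable R : comUnitRingType.
Variable N : nat.
Local Notation S F := (\sum_(1 <= n < N.+1) F n).
Local Notation x := (@dlambert R).
Local Notation y := (@ddlambert R).
Local Notation l := (@lambert R).

Lemma lambert_dvd k : exists h, l k = 'q ^+ k * h.
Proof. by exists (1 - 'q ^+ k)^-1. Qed.
Lemma dlambert_dvd k : exists h, x k = 'q ^+ k * h.
Proof.
by rewrite /dlambert; have [h ->] := lambert_dvd k; exists (h * (1 + 'q ^+ k * h)); ring.
Qed.
Lemma ddlambert_dvd k : exists h, y k = 'q ^+ k * h.
Proof.
by rewrite /ddlambert; have [h ->] := dlambert_dvd k; exists (h * (1 + 2 * lambert k)); ring.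
Qed.

Definition esym2 : fps R := \sum_(1 <= n < N.+1) x n * \sum_(1 <= m < n) x m.

Lemma sqr_sum_dlambert : (S x) ^+ 2 = S (fun n => x n ^+ 2) + 2 * esym2.
Proof.
rewrite expr2 mul_sum_diag -addrA /esym2.
by under eq_bigr do rewrite -expr2; congr (_ + _); ring.
Qed.

(** [Y] and [G] collect y_n (1 + l_m + l_(n-m)) summed over 0 < m < n; the factor n - 1 counts the
    values of m. *)
Let Y := S (fun n => y n * (n%:R - 1)).
Let G := S (fun n => y n * \sum_(1 <= m < n) l m).

Lemma sum_add1_lambert n : (0 < n)%N ->
  \sum_(1 <= m < n) (1 + l m + l (n - m)) = (n%:R - 1) + 2 * \sum_(1 <= m < n) l m.
Proof.
move=> n0; rewrite !big_split /= sum_rev big_const_nat iter_addr_0 natrB //; ring.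
Qed.

(** Convolve [dlambert] with itself and apply [dlambert_mul] at (m, n - m): the off-diagonal
    products give [2 * esym2] on both sides and cancel. *)
Lemma sum_sqr_dlambert : eqq N (S (fun n => x n ^+ 2)) (Y + 2 * G).
Proof.
have := @eqq_convolution _ _ _ N dlambert_dvd dlambert_dvd; rewrite -expr2 sqr_sum_dlambert.
have -> : \sum_(1 <= n < N.+1) \sum_(1 <= m < n) x m * x (n - m) = Y + 2 * G + 2 * esym2.
  rewrite /Y /G /esym2 !mulr_sumr -!big_split /=; apply: eq_big_nat => n /andP[n0 _].
  transitivity (\sum_(1 <= m < n) (y n * (1 + l m + l (n - m)) + x n * (x m + x (n - m)%N))).
    by apply: eq_big_nat => m /andP[m0 mn]; rewrite dlambert_mul ?subn_gt0 // subnKC // ltnW.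
  rewrite big_split /= -!mulr_sumr sum_add1_lambert // big_split /= sum_rev; ring.
move=> H n nN; have := H n nN; rewrite coefqD [in RHS]coefqD; exact: addIr.
Qed.

(** Convolve [ddlambert] with [lambert]: one copy of [G] and the sum of l_n y_m over m < n occur on
    both sides and cancel. *)
Lemma sum_ddlambert_lambert : eqq N (S (fun n => y n * l n)) (Y + G + 2 * esym2).
Proof.
have := @eqq_convolution _ _ _ N ddlambert_dvd lambert_dvd; rewrite mul_sum_diag.
have -> : \sum_(1 <= n < N.+1) \sum_(1 <= m < n) y m * l (n - m) =
   (Y + G + 2 * esym2) + (G + S (fun n => l n * \sum_(1 <= m < n) y m)).
  rewrite /Y /G /esym2 !mulr_sumr -!big_split /=; apply: eq_big_nat => n /andP[n0 _].
  transitivity (\sum_(1 <= m < n) (y n * (1 + l m + l (n - m)) + 2 * (x n * x m) + l n * y m)).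
    by apply: eq_big_nat => m /andP[m0 mn];
      rewrite ddlambert_lambert_mul ?subn_gt0 // subnKC // ltnW.
  rewrite 2!big_split /= -!mulr_sumr sum_add1_lambert //; ring.
by rewrite -addrA -/G => H n nN; have := H n nN; rewrite coefqD [in RHS]coefqD; exact: addIr.
Qed.

(* The equation [q dE2/dq = (E2^2 - E4)/12], with [E2 = 1 - 24 sum x_k]; the
   divisor sum of [E4] is eliminated through [sum x_k^2]. *)
Lemma ramanujan :
  eqq N (2 * (S x) ^+ 2) (5 * S (fun n => x n ^+ 2) + S x - S (fun n => n%:R * y n)).
Proof.
(* Termwise, x = y (1 + 2l) - 4x^2, because y = x (1 + 2l) and (1 + 2l)^2 = 1 + 4x. *)
have eX : S x = 2 * S (fun n => y n * l n) + S y - 4 * S (fun n => x n ^+ 2).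
  rewrite !mulr_sumr -sumrN -!big_split /=; apply: eq_bigr => n _.
  rewrite /ddlambert /dlambert; ring.
have eY : S (fun n => n%:R * y n) = Y + S y.
  by rewrite /Y -big_split /=; apply: eq_bigr => n _; ring.
rewrite sqr_sum_dlambert eY eX.
set s := S (fun n => x n ^+ 2); set yl := S (fun n => y n * l n).
have -> : 5 * s + (2 * yl + S y - 4 * s) - (Y + S y) = s + 2 * yl - Y by ring.
(* The left side is [s + s + 4 * esym2]. Replacing one [s] there, and [yl] on the right, by the two
   convolution identities gives the same expression. *)
apply: (@eqq_trans _ _ (s + 2 * (Y + G + 2 * esym2) - Y)).
  have -> : s + 2 * (Y + G + 2 * esym2) - Y = s + (Y + 2 * G) + 4 * esym2 by ring.
  have -> : 2 * (s + 2 * esym2) = s + s + 4 * esym2 by ring.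
  apply: eqqD => //; apply: eqqD => //; exact: sum_sqr_dlambert.
apply: eqqB => //; apply: eqqD => //; apply: eqqMl; apply: eqq_sym; exact: sum_ddlambert_lambert.
Qed.
End Ramanujan.

(** * The connected sum *)

Section Qfact.
Variable R : comUnitRingType.
Implicit Types a : fps R.

Lemma qpoch0 a : qpoch a 0 = 1.
Proof. by rewrite /qpoch big_ord0. Qed.

Lemma unit_qpoch a n : a 0%N = 0 -> qpoch a n \is a GRing.unit.
Proof.
move=> a0; rewrite /qpoch; apply: rpred_prod => k _.
by rewrite unit_fpsE coefqB coefqM big_ord1 a0 mul0r subr0 coefq1 unitr1.
Qed.

Lemma unit_qpochoo a : a 0%N = 0 -> qpochoo a \is a GRing.unit.
Proof. by move=> a0; rewrite unit_fpsE qpochoo0 // unitr1. Qed.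

Lemma unit_qfact n : qpoch ('q : fps R) n \is a GRing.unit.
Proof. exact: unit_qpoch. Qed.

Lemma qfactS n : qpoch 'q n.+1 = qpoch 'q n * (1 - 'q ^+ n.+1) :> fps R.
Proof. by rewrite qpochS -exprS. Qed.

Lemma qfactD m n : qpoch 'q (m + n) = qpoch 'q m * qpoch ('q ^+ m.+1) n :> fps R.
Proof.
elim: n => [|n IH]; first by rewrite addn0 qpoch0 mulr1.
by rewrite addnS qfactS IH qpochS -exprD -addSn mulrA.
Qed.

(** As [a] has no constant term, the factor 1 - a q^K is already 1 modulo q^(K+1), so [N] factors
    suffice, one fewer than in [qpochooE]. *)
Lemma eqq_qpoch a N K : a 0%N = 0 -> (N <= K)%N -> eqq N (qpoch a K) (qpochoo a).
Proof.
move=> a0 NK n nN; rewrite -(@qpochooE _ a n K.+1); last by lia.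
rewrite qpochS mulrBr mulr1 coefqB.
have -> : qpoch a K * (a * 'q ^+ K) = 'q ^+ K * (a * qpoch a K) by ring.
rewrite coefqXnM; case: ltnP => [|Kn]; first by rewrite subr0.
have -> : (n - K)%N = 0%N by lia.
by rewrite coefqM big_ord1 a0 mul0r subr0.
Qed.
End Qfact.

Section Connector.
Variable R : comUnitRingType.
Implicit Types m n k N : nat.

Definition conn m n : fps R :=
  'q ^+ (m * n) * qpoch 'q m * qpoch 'q n / qpoch 'q (m + n).

Lemma connC m n : conn m n = conn n m.
Proof. rewrite /conn mulnC addnC; congr (_ / _); exact: mulrAC. Qed.

Lemma conn0 n : conn 0 n = 1.
Proof. by rewrite /conn mul0n add0n expr0 qpoch0 !mul1r divrr ?unit_qfact. Qed.

(** Up to the common factor C(m,n) / (1 - q^(m+n+1)), C(m,n) - C(m,n+1) is 1 - q^m and C(m,n+1) is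
    q^m (1 - q^(n+1)). *)
Lemma conn_step m n : (0 < m)%N ->
  lambert m * (conn m n - conn m n.+1) = conn m n.+1 / (1 - 'q ^+ n.+1).
Proof.
move=> m0; rewrite /conn /lambert addnS !qfactS invrM ?unit_qfact ?unit_1subX //.
set u := (1 - 'q ^+ m)^-1; set b := 1 - 'q ^+ n.+1; set c := (1 - 'q ^+ (m + n).+1)^-1.
have eu : u * (1 - 'q ^+ m) = 1 by rewrite mulVr ?unit_1subX.
have ec : c * (1 - 'q ^+ (m + n).+1) = 1 by rewrite mulVr ?unit_1subX.
have eb : b / b = 1 by rewrite divrr ?unit_1subX.
set K := 'q ^+ (m * n) * qpoch 'q m * qpoch 'q n / qpoch 'q (m + n).
have -> : 'q ^+ (m * n.+1) * qpoch 'q m * (qpoch 'q n * b) * (c / qpoch 'q (m + n))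
   = 'q ^+ m * K * b * c by rewrite mulnS exprD /K; ring.
transitivity ('q ^+ m * K * c * (u * (1 - 'q ^+ m))); last first.
  by rewrite eu -eb; ring.
have -> : 1 - 'q ^+ m = (1 - 'q ^+ (m + n).+1) - 'q ^+ m * b :> fps R.
  by rewrite /b -addnS exprD; ring.
transitivity ('q ^+ m * u * K * (c * (1 - 'q ^+ (m + n).+1)) - 'q ^+ m * u * ('q ^+ m * K * b * c)).
  by rewrite ec; ring.
ring.
Qed.

Lemma conn_sum m n N : (0 < m)%N -> (n <= N)%N ->
  \sum_(n.+1 <= k < N.+1) conn m k / (1 - 'q ^+ k) = lambert m * (conn m n - conn m N).
Proof.
move=> m0 /subnKC <-; elim: (N - n)%N => [|d IH].
  by rewrite addn0 big_geq // subrr mulr0.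
by rewrite addnS big_nat_recr /= ?IH ?ltnS ?leq_addr // -conn_step //; ring.
Qed.

(** Disposes of the upper boundary term of the telescoping sum [conn_sum]: it carries q^(m + mN)
    with m >= 1. *)
Lemma lambert_conn0 N m f : (0 < m)%N -> eqq N (f * (lambert m * conn m N)) 0.
Proof.
move=> m0; have [h ->] := lambert_dvd R m.
have -> : f * ('q ^+ m * h * conn m N) = 'q ^+ (m + m * N) *
    (f * h * qpoch 'q m * qpoch 'q N / qpoch 'q (m + N)).
  by rewrite /conn exprD; ring.
by apply: eqqMX0; nia.
Qed.

(** Two transports through the connector, with x_k = l_k [V k]: [conn_sum] trades l_m for a sum over
    k > n of C(m,k) [V k]; by symmetry the sum over m of C(m,k) [V m] then closes up to l_k. *)
Lemma connected_sum N :
  eqq N (\sum_(1 <= m < N.+1) \sum_(1 <= n < N.+1) dlambert m * dlambert n * conn m n)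
    (esym2 R N).
Proof.
pose V k := (1 - 'q ^+ k : fps R)^-1.
have xV k : (0 < k)%N -> dlambert k = lambert k * V k by move=> k0; rewrite /dlambert add1_lambert.
apply: (@eqq_trans _ _ (\sum_(1 <= m < N.+1) \sum_(1 <= n < N.+1)
    V m * dlambert n * \sum_(n.+1 <= k < N.+1) conn m k * V k)).
  apply: eqq_sum => m; rewrite mem_index_iota => /andP[m0 mN].
  apply: eqq_sum => n; rewrite mem_index_iota => /andP[n0 nN].
  rewrite conn_sum // mulrBr [X in eqq _ _ X]mulrBr.
  apply: eqq_sym; apply: eqq_trans; first by apply: eqq_subl; exact: lambert_conn0.
  by rewrite (xV m) //; have -> : V m * dlambert n * (lambert m * conn m n) =
    lambert m * V m * dlambert n * conn m n by ring.
have -> : \sum_(1 <= m < N.+1) \sum_(1 <= n < N.+1)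
    V m * dlambert n * (\sum_(n.+1 <= k < N.+1) conn m k * V k) =
  \sum_(1 <= n < N.+1) \sum_(n.+1 <= k < N.+1)
    dlambert n * V k * \sum_(1 <= m < N.+1) conn m k * V m.
  rewrite exchange_big /=; apply: eq_bigr => n _.
  under eq_bigr do rewrite mulr_sumr.
  rewrite exchange_big /=; apply: eq_bigr => k _.
  by rewrite mulr_sumr; apply: eq_bigr => m _; ring.
(* The sum over m starts at 1, so its lower boundary term is C(k,0) = 1. *)
apply: (@eqq_trans _ _ (\sum_(1 <= n < N.+1) \sum_(n.+1 <= k < N.+1) dlambert n * dlambert k)).
  apply: eqq_sum => n; rewrite mem_index_iota => /andP[n0 nN].
  apply: eqq_sum => k; rewrite mem_index_iota => /andP[k0 kN].
  under eq_bigr do rewrite connC.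
  rewrite (@conn_sum k 0 N) //; last by lia.
  rewrite connC conn0 mulrBr mulr1 mulrBr.
  apply: eqq_trans; first by apply: eqq_subl; apply: lambert_conn0; lia.
  by rewrite (xV k); [have -> : dlambert n * V k * lambert k = dlambert n * (lambert k * V k) by ring|lia].
rewrite -(exchange_triangle (fun n k => dlambert n * dlambert k)) /esym2.
under [X in eqq _ _ X]eq_bigr do rewrite mulr_sumr.
apply: eqq_sum => n _; apply: eqq_sum => m _; by rewrite mulrC.
Qed.
End Connector.

(** * The generating function of SPT^- *)

Lemma eqq_qpochooV (R : comUnitRingType) m N :
  eqq N (qpochoo ('q ^+ m.+1))^-1 (qpoch 'q m * partgf N : fps R).
Proof.
have q0 : ('q ^+ m.+1 : fps R) 0%N = 0 by exact: coefqX0.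
have uA := unit_qpochoo q0; have um := @unit_qfact R m; have uN := @unit_qfact R N.
have -> : (qpochoo ('q ^+ m.+1))^-1 =
    qpoch 'q m * (qpoch 'q m * qpochoo ('q ^+ m.+1))^-1 :> fps R.
  by rewrite invrM // mulrCA divrr // mulr1.
apply: eqqMl; apply: eqqV => //; first by rewrite unitrM um.
apply: (@eqq_trans _ _ (qpoch 'q (m + N))).
  by rewrite qfactD; apply: eqqMl; apply: eqq_sym; exact: eqq_qpoch.
apply: (@eqq_trans _ _ (qpochoo 'q)); first by apply: eqq_qpoch; rewrite ?leq_addl.
by apply: eqq_sym; apply: eqq_qpoch.
Qed.

(** Since (q^(n+1);q)_m = (q;q)_(m+n) / (q;q)_n, the factor (q;q)_m released by the outer sum
    through [eqq_qpochooV] completes the connector. *)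
Lemma spt_minus_termE m n : (0 < n)%N ->
  qpoch 'q m * spt_minus_term m n = dlambert n * conn int m n.
Proof.
move=> n0; rewrite /spt_minus_term dlambertE // /conn [(m + n)%N in RHS]addnC qfactD exprD.
have up := @unit_qpoch int ('q ^+ n.+1) m (coefqX0 _ (ltn0Sn n)).
rewrite !invrM ?unitrX ?unit_1subX ?unit_qfact //.
(* On the right (q;q)_n stands over itself; the same quotient is inserted on the left. *)
rewrite -[LHS]mulr1 -[in X in _ * X](divrr (unit_qfact int n)); ring.
Qed.

Lemma spt_minus_esym2 n : spt_minus n = (partgf n * esym2 int n) n.
Proof.
suff H N : eqq N (\sum_(1 <= n1 < N.+1)
    ('q ^+ n1 / ((1 - 'q ^+ n1) ^+ 2 * qpochoo ('q ^+ n1.+1))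
     * \sum_(1 <= n2 < N.+1) spt_minus_term n1 n2)) (partgf N * esym2 int N).
  by rewrite spt_minusE -coefq_sum H.
clear n; apply: eqq_trans; last by apply: eqqMl; exact: connected_sum.
rewrite mulr_sumr; apply: eqq_sum => m; rewrite mem_index_iota => /andP[m0 _].
have um2 : (1 - 'q ^+ m : fps int) ^+ 2 \is a GRing.unit by rewrite unitrX ?unit_1subX.
rewrite invrM ?unit_qpochoo ?coefqX0 //.
apply: eqq_trans.
  apply: (eqqM _ (eqq_refl _)).
  by apply: eqqMl; apply: (eqqM _ (eqq_refl _)); exact: eqq_qpochooV.
rewrite !mulr_sumr; apply: eqq_sum => n; rewrite mem_index_iota => /andP[n0 _].
rewrite dlambertE //.
have -> : 'q ^+ m * (qpoch 'q m * partgf N / (1 - 'q ^+ m) ^+ 2) * spt_minus_term m n =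
  partgf N * ('q ^+ m / (1 - 'q ^+ m) ^+ 2 * (qpoch 'q m * spt_minus_term m n)) by ring.
by rewrite spt_minus_termE // [_ * (dlambert n * _)]mulrA.
Qed.

(** * Derivatives of the partition generating function *)

Section Derivation.
Variable R : comUnitRingType.
Implicit Types f g : fps R.

(** The derivation q d/dq; it turns p(n) into n p(n). *)
Definition qder f : fps R := Fps (fun n => n%:R * f n).

Lemma eqq_qder N f g : eqq N f g -> eqq N (qder f) (qder g).
Proof. by move=> fg n nN; rewrite /= fg. Qed.

Lemma qderD f g : qder (f + g) = qder f + qder g.
Proof. by apply/fpsP => n /=; rewrite mulrDr. Qed.

Lemma qder0 : qder 0 = 0.
Proof. by apply/fpsP => n /=; rewrite mulr0. Qed.

Lemma qder1 : qder 1 = 0.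
Proof. by apply/fpsP => -[|n] /=; rewrite ?mul0r ?mulr0. Qed.

Lemma qderM f g : qder (f * g) = qder f * g + f * qder g.
Proof.
apply/fpsP => n; rewrite /= mulr_sumr -big_split /=; apply: eq_bigr => i _.
have /subnKC : (i <= n)%N by rewrite -ltnS.
by move=> {1}<-; rewrite natrD; ring.
Qed.

Lemma qder_sum (I : Type) (r : seq I) (F : I -> fps R) :
  qder (\sum_(i <- r) F i) = \sum_(i <- r) qder (F i).
Proof. by apply: (big_morph _ qderD qder0). Qed.

Lemma qderX k : qder ('q ^+ k) = k%:R * 'q ^+ k.
Proof.
elim: k => [|k IH]; first by rewrite expr0 qder1 mul0r.
have qq : qder 'q = 'q.
  by apply/fpsP => -[|[|n]] /=; rewrite ?mul0r ?mulr0 ?mulr1.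
by rewrite exprS qderM IH qq mulrS; ring.
Qed.

Lemma qder_lambert k : (0 < k)%N -> qder (lambert k) = k%:R * dlambert k.
Proof.
move=> k0; apply: (mulIr (unit_1subX R k0)).
have e : lambert k * (1 - 'q ^+ k) = 'q ^+ k :> fps R by rewrite mulrVK ?unit_1subX.
have e' : lambert k - lambert k * 'q ^+ k = 'q ^+ k :> fps R by rewrite -[RHS]e; ring.
have := congr1 qder e'.
have -> : lambert k - lambert k * 'q ^+ k = lambert k * (1 - 'q ^+ k) :> fps R by ring.
rewrite qderM.
have -> : qder (1 - 'q ^+ k) = - (k%:R * 'q ^+ k).
  have := qderD (1 - 'q ^+ k) ('q ^+ k); rewrite subrK qder1 qderX => /esym/eqP.
  by rewrite addr_eq0 => /eqP.
rewrite qderX => /eqP; rewrite mulrN subr_eq => /eqP ->.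
transitivity (k%:R * (1 + lambert k) * (lambert k * (1 - 'q ^+ k)) : fps R);
  last by rewrite /dlambert; ring.
by rewrite e; ring.
Qed.

Lemma qder_dlambert k : (0 < k)%N -> qder (dlambert k) = k%:R * ddlambert k.
Proof.
by move=> k0; rewrite /ddlambert /dlambert qderM qderD qder1 !qder_lambert // /dlambert; ring.
Qed.

Lemma partgfS n : partgf n.+1 = partgf n * (1 + lambert n.+1) :> fps R.
Proof.
by rewrite /partgf qfactS invrM ?unit_qfact ?unit_1subX // add1_lambert // mulrC.
Qed.

(** Logarithmic differentiation: the factor 1 + l_k = 1/(1 - q^k) contributes k x_k / (1 + l_k) = k
    l_k. *)
Lemma qder_partgf N : qder (partgf N) = partgf N * \sum_(1 <= k < N.+1) k%:R * lambert k.
Proof.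
elim: N => [|N IH]; first by rewrite /partgf qpoch0 invr1 big_geq // mulr0 qder1.
rewrite partgfS qderM IH qderD qder1 qder_lambert // (@big_nat_recr _ _ _ N.+1) //=.
rewrite /dlambert; ring.
Qed.

Lemma lambert_series k N : (0 < k)%N ->
  eqq N (@lambert R k) (\sum_(1 <= j < N.+1) 'q ^+ (j * k)).
Proof.
move=> k0; have -> : \sum_(1 <= j < N.+1) 'q ^+ (j * k) =
    lambert k - 'q ^+ (N * k) * lambert k :> fps R.
  apply: (mulIr (unit_1subX R k0)).
  have e : lambert k * (1 - 'q ^+ k) = 'q ^+ k :> fps R by rewrite mulrVK ?unit_1subX.
  have -> : (lambert k - 'q ^+ (N * k) * lambert k) * (1 - 'q ^+ k) =
    'q ^+ k - 'q ^+ (N * k) * 'q ^+ k :> fps R by rewrite -[in RHS]e; ring.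
  elim: N => [|N IH].
    by rewrite big_geq // mul0n expr0; ring.
  by rewrite big_nat_recr //= mulrDl IH mulSn exprD; ring.
apply: eqq_sym; apply: eqq_subl.
by rewrite /lambert mulrA -exprD; apply: eqqMX0; nia.
Qed.

Lemma dlambert_series k N : (0 < k)%N ->
  eqq N (@dlambert R k) (\sum_(1 <= j < N.+1) j%:R * 'q ^+ (j * k)).
Proof.
(* With a = q^k, the tail over j > N is a^N times the sum of (N + i) a^i over i >= 1. *)
move=> k0; have -> : \sum_(1 <= j < N.+1) j%:R * 'q ^+ (j * k) =
    dlambert k - 'q ^+ (N * k) * (dlambert k + N%:R * lambert k) :> fps R.
  apply: (mulIr (unit_1subX R k0)).
  have e : lambert k * (1 - 'q ^+ k) = 'q ^+ k :> fps R by rewrite mulrVK ?unit_1subX.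
  have ex : dlambert k * (1 - 'q ^+ k) = 'q ^+ k * (1 + lambert k) :> fps R.
    by rewrite /dlambert -[in RHS]e; ring.
  have -> : (dlambert k - 'q ^+ (N * k) * (dlambert k + N%:R * lambert k)) * (1 - 'q ^+ k) =
     dlambert k * (1 - 'q ^+ k) - 'q ^+ (N * k) *
       (dlambert k * (1 - 'q ^+ k) + N%:R * (lambert k * (1 - 'q ^+ k))) :> fps R by ring.
  rewrite ex e; elim: N => [|N IH].
    by rewrite big_geq // mul0n expr0; ring.
  rewrite big_nat_recr //= mulrDl IH mulSn exprD mulrS.
  apply/eqP; rewrite -subr_eq0; apply/eqP.
  transitivity ('q ^+ (N * k) * 'q ^+ k * (lambert k * ('q ^+ k - 1) + 'q ^+ k) : fps R).
    ring.
  by rewrite -opprB mulrN e addNr mulr0.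
apply: eqq_sym; apply: eqq_subl; have [h ->] := dlambert_dvd R k; rewrite /lambert.
have -> : 'q ^+ (N * k) * ('q ^+ k * h + N%:R * ('q ^+ k / (1 - 'q ^+ k)))
    = 'q ^+ (N * k + k) * (h + N%:R / (1 - 'q ^+ k)) by rewrite exprD; ring.
by apply: eqqMX0; nia.
Qed.

(** Both sides expand to the double sum of k q^(jk), read in the two orders. *)
Lemma sum_nat_lambert N :
  eqq N (\sum_(1 <= k < N.+1) k%:R * lambert k) (\sum_(1 <= k < N.+1) dlambert k : fps R).
Proof.
apply: (@eqq_trans _ _
    (\sum_(1 <= k < N.+1) \sum_(1 <= j < N.+1) k%:R * 'q ^+ (j * k))).
  apply: eqq_sum => k; rewrite mem_index_iota => /andP[k0 _].
  by rewrite -mulr_sumr; apply: eqqMl; exact: lambert_series.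
rewrite exchange_big /=; apply: eqq_sum => k; rewrite mem_index_iota => /andP[k0 _].
apply: eqq_sym; apply: eqq_trans; first exact: (@dlambert_series _ N).
by under eq_bigr do rewrite mulnC.
Qed.

Lemma qder_partgf_h1 N :
  eqq N (qder (@partgf R N)) (partgf N * \sum_(1 <= k < N.+1) dlambert k).
Proof. by rewrite qder_partgf; apply: eqqMl; exact: sum_nat_lambert. Qed.

Lemma qder2_partgf N :
  eqq N (qder (qder (@partgf R N)))
    (partgf N * ((\sum_(1 <= k < N.+1) dlambert k) ^+ 2
                 + \sum_(1 <= k < N.+1) k%:R * ddlambert k)).
Proof.
apply: eqq_trans; first by apply: eqq_qder; exact: qder_partgf_h1.
rewrite qderM mulrDr expr2 mulrA; apply: eqqD.
  by apply: eqqM => //; exact: qder_partgf_h1.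
rewrite qder_sum; apply: eqqMl; apply: eqq_sum => k.
by rewrite mem_index_iota => /andP[k0 _]; rewrite qder_dlambert.
Qed.
End Derivation.

(** * Cranks *)

Section Scalars.
Variable R : comUnitRingType.

Lemma fpsCD (a b : R) : fpsC (a + b) = fpsC a + fpsC b.
Proof. by apply/fpsP => -[|n] //=; rewrite addr0. Qed.

Lemma fpsCM (a b : R) : fpsC (a * b) = fpsC a * fpsC b.
Proof. by apply/fpsP => n; rewrite coefqCM; case: n => [|n] //=; rewrite mulr0. Qed.

Lemma fpsC1 : fpsC (1 : R) = 1.
Proof. by apply/fpsP => -[]. Qed.

Lemma fpsC2B (a : R) : fpsC (a - 2) = fpsC a - 2.
Proof.
apply/eqP; rewrite eq_sym subr_eq; apply/eqP.
have -> : 2 = fpsC 2 :> fps R by rewrite -[2 in RHS]/(1 + 1) fpsCD fpsC1.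
by rewrite -fpsCD subrK.
Qed.
End Scalars.

Section Crank.
Variable R : comUnitRingType.

Definition hsym1 N : fps R := \sum_(1 <= k < N.+1) dlambert k.
Definition hsym2 N : fps R :=
  \sum_(1 <= n < N.+1) dlambert n * \sum_(1 <= m < n.+1) dlambert m.

Lemma hsym2E N : hsym2 N = \sum_(1 <= n < N.+1) dlambert n ^+ 2 + esym2 R N.
Proof.
rewrite /hsym2 /esym2 -big_split /=; apply: eq_big_nat => n /andP[n0 _].
by rewrite big_nat_recr //=; ring.
Qed.

(** The product of the 1/(1 - T x_k) generates the complete symmetric functions. Order T^2 is
    enough: T will be divisible by u^2, and only coefficients up to u^4 are read. *)
Lemma prod_h_expansion (T : fps R) N : exists r,
  (\prod_(1 <= k < N.+1) (1 - T * dlambert k)) * (1 + T * hsym1 N + T ^+ 2 * hsym2 N)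
  = 1 + T ^+ 3 * r.
Proof.
elim: N => [|N [r IH]].
  by exists 0; rewrite /hsym1 /hsym2 !big_geq //; ring.
(* With x = x_(N+1) and h_j' the values at N+1, (1 - T x)(1 + T h_1' + T^2 h_2') = 1 + T h_1 + T^2
   h_2 - T^3 x h_2'. *)
exists (r - \prod_(1 <= k < N.+1) (1 - T * dlambert k) * dlambert N.+1 * hsym2 N.+1).
rewrite (@big_nat_recr _ _ _ N.+1) //=.
have e2 : hsym2 N.+1 = hsym2 N + dlambert N.+1 * hsym1 N.+1.
  by rewrite /hsym2 (@big_nat_recr _ _ _ N.+1).
have e1 : hsym1 N.+1 = hsym1 N + dlambert N.+1 by rewrite /hsym1 (@big_nat_recr _ _ _ N.+1).
rewrite [T ^+ 3 * _]mulrBr addrA -IH e2 e1; ring.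
Qed.

Variables (z w : R).
Hypothesis zw : z * w = 1.
Let T := fpsC (z + w - 2).

Lemma crank_den N :
  qpoch (fpsC z * 'q) N * qpoch (fpsC w * 'q) N =
  qpoch 'q N ^+ 2 * \prod_(1 <= k < N.+1) (1 - T * dlambert k).
Proof.
elim: N => [|N IH]; first by rewrite !qpoch0 big_geq // expr1n !mul1r.
rewrite qfactS exprMn (@big_nat_recr _ _ _ N.+1) //= [RHS]mulrACA -IH !qpochS.
rewrite mulrACA; congr (_ * _).
have e : (1 - 'q ^+ N.+1) ^+ 2 * dlambert N.+1 = 'q ^+ N.+1 :> fps R.
  by rewrite dlambertE // mulrC mulrVK // unitrX ?unit_1subX.
have ezw : fpsC z * fpsC w = 1 by rewrite -fpsCM zw fpsC1.
have eq c : c * 'q * 'q ^+ N = c * 'q ^+ N.+1 :> fps R by rewrite exprS mulrA.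
rewrite !eq.
have -> : (1 - 'q ^+ N.+1) ^+ 2 * (1 - T * dlambert N.+1) =
    (1 - 'q ^+ N.+1) ^+ 2 - T * ((1 - 'q ^+ N.+1) ^+ 2 * dlambert N.+1) by ring.
rewrite e /T fpsC2B fpsCD.
transitivity (1 - (fpsC z + fpsC w) * 'q ^+ N.+1 + fpsC z * fpsC w * 'q ^+ N.+1 ^+ 2).
  ring.
by rewrite ezw; ring.
Qed.

Lemma unit_prod_dlambert (U : fps R) N :
  \prod_(1 <= k < N.+1) (1 - U * dlambert k) \is a GRing.unit.
Proof.
rewrite big_nat_cond; apply: rpred_prod => k /andP[/andP[k0 _] _].
have [h ->] := dlambert_dvd R k.
by rewrite mulrCA unit_fpsE coefqB coefqXnM k0 subr0 coefq1 unitr1.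
Qed.

Lemma crank_gf_expansion N : exists r, eqq N (crank_gf z w)
  (partgf N + T * (partgf N * hsym1 N) + T ^+ 2 * (partgf N * hsym2 N) + T ^+ 3 * r).
Proof.
have [r Er] := prod_h_expansion T N; set E := \prod_(_ <= _ < _) _ in Er.
have uE : E \is a GRing.unit by exact: unit_prod_dlambert.
exists (- (partgf N * E^-1 * r)).
have c0 (c : R) : (fpsC c * 'q) 0%N = 0 by rewrite coefqCM mulr0.
apply: (@eqq_trans _ _ (qpoch 'q N / (qpoch (fpsC z * 'q) N * qpoch (fpsC w * 'q) N))).
  apply: eqqM; first by apply: eqq_sym; exact: eqq_qpoch.
  apply: eqqV; rewrite ?unitrM ?unit_qpochoo ?unit_qpoch ?c0 //.
  by apply: eqqM; apply: eqq_sym; apply: eqq_qpoch; rewrite ?c0.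
have uQ := unit_qfact R N.
set A := 1 + T * hsym1 N + T ^+ 2 * hsym2 N in Er.
(* Divide [Er] by [E]. *)
have eE : E^-1 = A - E^-1 * (T ^+ 3 * r) by rewrite -[X in X - _](mulKr uE) Er; ring.
have -> : partgf N + T * (partgf N * hsym1 N) + T ^+ 2 * (partgf N * hsym2 N)
    + T ^+ 3 * - (partgf N / E * r) = partgf N * (A - E^-1 * (T ^+ 3 * r)).
  by rewrite /A; ring.
rewrite -eE crank_den -/E invrM ?unitrX // expr2 invrM //.
set Q := qpoch 'q N in uQ *.
have -> : Q * (E^-1 * (Q^-1 * Q^-1)) = (Q / Q) * (Q^-1 * E^-1) by ring.
by rewrite divrr // mul1r.
Qed.

Lemma crank_gf_coef_expansion n : let t := z + w - 2 in exists r,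
  crank_gf z w n = partgf n n + t * (partgf n * hsym1 n) n
    + t ^+ 2 * (partgf n * hsym2 n) n + t ^+ 3 * r.
Proof.
have [r Er] := crank_gf_expansion n; exists (r n); rewrite Er // !coefqD.
have TX k : T ^+ k = fpsC ((z + w - 2) ^+ k).
  by elim: k => [|k IH]; rewrite ?expr0 ?fpsC1 // !exprS IH fpsCM.
by rewrite !TX /T !coefqCM.
Qed.
End Crank.

(** * Change of the coefficient ring *)

Section MapSeries.
Variables (R S : comUnitRingType) (phi : {rmorphism R -> S}).

Lemma map_partgf n : map_fps phi (partgf n) = partgf n.
Proof. by rewrite /partgf rmorphV ?unit_qfact //= map_qpoch map_fpsX. Qed.

Lemma map_dlambert k : (0 < k)%N -> map_fps phi (dlambert k) = dlambert k.
Proof.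
move=> k0; rewrite !dlambertE // rmorphM rmorphV ?unitrX ?unit_1subX //=.
by rewrite !rmorphXn rmorphB rmorph1 !rmorphXn /= map_fpsX.
Qed.

Lemma map_hsym1 N : map_fps phi (hsym1 R N) = hsym1 S N.
Proof.
by rewrite /hsym1 rmorph_sum; apply: eq_big_nat => k /andP[k0 _]; exact: map_dlambert.
Qed.

Lemma map_hsym2 N : map_fps phi (hsym2 R N) = hsym2 S N.
Proof.
rewrite /hsym2 rmorph_sum; apply: eq_big_nat => k /andP[k0 _].
rewrite rmorphM rmorph_sum /= map_dlambert //; congr (_ * _).
by apply: eq_big_nat => m /andP[m0 _]; exact: map_dlambert.
Qed.

(** For z = 1 + u the coefficients of the crank expansion lie in [fps rat]; these lemmas show them
    to be images of integers, hence constant in u. *)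
Lemma rmorph_partgf N n : phi (partgf N n) = partgf N n.
Proof. by rewrite -map_partgf. Qed.

Lemma rmorph_partgf_hsym1 N n : phi ((partgf N * hsym1 R N) n) = (partgf N * hsym1 S N) n.
Proof. by rewrite -map_partgf -map_hsym1 -rmorphM. Qed.

Lemma rmorph_partgf_hsym2 N n : phi ((partgf N * hsym2 R N) n) = (partgf N * hsym2 S N) n.
Proof. by rewrite -map_partgf -map_hsym2 -rmorphM. Qed.
End MapSeries.

(** * The crank generating function at z = 1 + u *)

Lemma coefq_mulrz (R : comNzRingType) (f : fps R) (m : int) k :
  (f *~ m) k = f k *~ m.
Proof.
have nat_case (j : nat) : (f *+ j) k = f k *+ j.
  by elim: j => [|j IH]; rewrite ?mulr0n // !mulrS coefqD IH.
by case: m => j; rewrite -?pmulrn ?NegzE ?mulrNz ?coefqN -?pmulrn nat_case.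
Qed.

(** The series variable of [fps rat] plays the role of u = z - 1; the q of the crank series is the
    outer variable, in [fps (fps rat)]. *)
Notation z1 := (1 + 'q : fps rat).

Lemma unit_zz : z1 \is a GRing.unit.
Proof. by rewrite unit_fpsE coefqD coefq1 addr0 unitr1. Qed.

(** The first coefficients of (1 + u)^m, written as polynomials in [m] so that negative exponents
    are covered. *)
Definition binom_coefs (f : fps rat) (m : rat) :=
  [/\ f 0%N = 1, f 1%N = m, f 2%N = m * (m - 1) / 2,
      f 3%N = m * (m - 1) * (m - 2) / 6
    & f 4%N = m * (m - 1) * (m - 2) * (m - 3) / 24].

(** Pascal's rule; the converse direction carries the induction down to negative exponents. *)
Lemma binom_coefsS f m : binom_coefs f m <-> binom_coefs (f * z1) (m + 1).
Proof.
have -> : f * z1 = f + 'q * f by ring.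
rewrite /binom_coefs !coefqD !coefqXM addr0; split.
  by move=> [-> -> -> -> ->]; split; field.
move=> [e0 e1 e2 e3 e4].
have f1 : f 1%N = m by apply: (addIr (f 0%N)); rewrite e1 e0.
have f2 : f 2%N = m * (m - 1) / 2 by apply: (addIr (f 1%N)); rewrite e2 f1; field.
have f3 : f 3%N = m * (m - 1) * (m - 2) / 6.
  by apply: (addIr (f 2%N)); rewrite e3 f2; field.
by split=> //; apply: (addIr (f 3%N)); rewrite e4 f3; field.
Qed.

Lemma binom_coefs_zz (m : int) : binom_coefs (z1 ^ m) m%:~R.
Proof.
have uz := unit_zz.
elim/int_ind: m => [|n IH|n IH].
- by rewrite expr0z mulr0z; split; rewrite coefq1 /= ?mul0r.
- rewrite -addn1 PoszD exprzDr // expr1z intrD; apply: (proj1 (binom_coefsS _ _)); exact: IH.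
- apply: (proj2 (binom_coefsS _ _)); rewrite -{2}(expr1z z1) -exprzDr //.
  have -> : - (n.+1)%:Z + 1 = - n%:Z by lia.
  by have -> : (- (n.+1)%:Z)%:~R + 1 = (- n%:Z)%:~R :> rat
    by rewrite -[1]/(1%:~R) -intrD; congr _%:~R; lia.
Qed.

Lemma crank_sum_coef n j :
  (crank_gf z1 z1^-1 n) j =
  \sum_(i < n.*2.+1) (crank (i%:Z - n%:Z) n)%:~R * (z1 ^ (i%:Z - n%:Z)) j.
Proof.
rewrite crank_genfun ?unit_zz // (@crank_sumE _ _ n).
  rewrite coefq_sum; apply: eq_bigr => i _.
  by rewrite mulrzl coefq_mulrz -mulrzl.
by move=> m nm; rewrite crank_eq0 // mul0r.
Qed.

Lemma crank_gf_zz n : exists r : fps rat,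
  crank_gf z1 z1^-1 n = (partgf n n : int)%:~R
    + 'q ^+ 2 * (z1^-1 *~ (partgf n * hsym1 int n) n)
    + 'q ^+ 4 * (z1 ^- 2 *~ (partgf n * hsym2 int n) n) + 'q ^+ 6 * r.
Proof.
have uz := unit_zz.
(* z + 1/z - 2 = (z - 1)^2 / z. *)
have t : z1 + z1^-1 - 2 = 'q ^+ 2 * z1^-1.
  apply: (mulIr uz); rewrite mulrVK // mulrBl mulrDl mulVr //; ring.
have [r ->] := crank_gf_coef_expansion (divrr uz) n; rewrite t.
have expand (A : comPzRingType) (x v p a b s : A) :
    p + x ^+ 2 * v * a + (x ^+ 2 * v) ^+ 2 * b + (x ^+ 2 * v) ^+ 3 * s =
    p + x ^+ 2 * (v * a) + x ^+ 4 * (v ^+ 2 * b) + x ^+ 6 * (v ^+ 3 * s) by ring.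
exists (z1 ^- 3 * r).
rewrite -[z1^-1 *~ _]mulrzr -[z1 ^- 2 *~ _]mulrzr.
rewrite (rmorph_partgf intr) (rmorph_partgf_hsym1 intr) (rmorph_partgf_hsym2 intr).
rewrite -!exprVn; set v := z1^-1.
exact: expand.
Qed.

(** Modulo u^5, u^2/z = u^2 - u^3 + u^4 and u^4/z^2 = u^4. The extra factor z in the last clause
    accounts for the shift in binom(j+1,4). *)
Lemma coef_crank_gf n :
  [/\ crank_gf z1 z1^-1 n 1%N = 0,
      crank_gf z1 z1^-1 n 2%N = ((partgf n * hsym1 int n) n)%:~R,
      crank_gf z1 z1^-1 n 3%N = - ((partgf n * hsym1 int n) n)%:~R,
      crank_gf z1 z1^-1 n 4%N =
        ((partgf n * hsym1 int n) n)%:~R + ((partgf n * hsym2 int n) n)%:~R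
    & (z1 * crank_gf z1 z1^-1 n) 4%N = ((partgf n * hsym2 int n) n)%:~R].
Proof.
have [r ->] := crank_gf_zz n.
set a := (_ * hsym1 _ _) n; set b := (_ * hsym2 _ _) n; set c := partgf n n.
have [v0 v1 v2 _ _] := binom_coefs_zz (-1); rewrite -[z1 ^ (-1)]/(z1^-1) in v0 v1 v2.
have [w0 _ _ _ _] := binom_coefs_zz (-2); rewrite -[z1 ^ (-2)]/(z1 ^- 2) in w0.
have -> f : z1 * f = f + 'q * f by rewrite mulrDl mul1r.
move: (z1^-1) (z1 ^- 2) v0 v1 v2 w0 => v w v0 v1 v2 w0.
have E k : (c%:~R + 'q ^+ 2 * (v *~ a) + 'q ^+ 4 * (w *~ b) + 'q ^+ 6 * r) k =
  (k == 0%N)%:R * c%:~R + (if (k < 2)%N then 0 else v (k - 2)%N * a%:~R)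
  + (if (k < 4)%N then 0 else w (k - 4)%N * b%:~R) + (if (k < 6)%N then 0 else r (k - 6)%N).
  by rewrite !coefqD !coefqXnM !coefq_mulrz coefq1 !mulrzr.
have EX (f : fps rat) : (f + fpsX _ * f) 4%N = f 4%N + f 3%N by rewrite coefqD coefqXM.
rewrite EX !E /= v0 v1 v2 w0.
by split; field.
Qed.

(** * Partitions *)

(** Lists the nonincreasing sequences of length [L] with entries at most [k] and sum [n]. Either the
    bound drops, or the first entry equals it and the length drops; the inner [fix] makes this
    recursion structural. *)
Fixpoint parts (L k n : nat) : seq (seq nat) :=
  match L with
  | 0 => if n == 0%N then [:: [::]] else [::]
  | L'.+1 => (fix aux k := match k with
      | 0 => if n == 0%N then [:: nseq L'.+1 0%N] else [::]
      | k'.+1 => aux k' ++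
          (if (k <= n)%N then map (cons k) (parts L' k (n - k)) else [::])
      end) k
  end.

Lemma parts0 L n : parts L 0 n = if n == 0%N then [:: nseq L 0%N] else [::].
Proof. by case: L. Qed.

Lemma partsS L k n : parts L.+1 k.+1 n = parts L.+1 k n ++
  (if (k < n)%N then map (cons k.+1) (parts L k.+1 (n - k.+1)) else [::]).
Proof. by []. Qed.

Definition is_part (L k n : nat) (s : seq nat) :=
  [&& size s == L, path geq k s & sumn s == n].

Lemma is_part0 L n s : is_part L 0 n s = (n == 0%N) && (s == nseq L 0%N).
Proof.
apply/idP/idP => [/and3P[/eqP <- ps /eqP <-]|/andP[/eqP -> /eqP ->]].
  elim: s ps => //= a s IH /andP[]; rewrite /geq /= leqn0 => /eqP -> /IH.
  by rewrite add0n eqseq_cons eqxx.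
by rewrite /is_part size_nseq eqxx sumn_nseq eqxx andbT /=; elim: L.
Qed.

Lemma path_geqS k s : path geq k.+1 s =
  path geq k s || (if s is a :: s' then (a == k.+1) && path geq k.+1 s' else false).
Proof.
case: s => //= a s; have -> : (a <= k.+1)%N = (a <= k)%N || (a == k.+1) by lia.
by rewrite andb_orl; congr (_ || _); case: eqP => [->|].
Qed.

Lemma mem_parts L k n s : (s \in parts L k n) = is_part L k n s.
Proof.
elim: L k n s => [|L IHL] k n s.
  by rewrite /= /is_part; case: s => [|a s]; case: eqP; case: n.
elim: k s => [|k IHk] s.
  by rewrite parts0 is_part0; case: eqP => //= _; rewrite inE.
rewrite partsS mem_cat IHk /is_part path_geqS.
case: s => [|a s]; first by case: ifP => // _; apply/negbTE/mapP => -[].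
have -> : (a :: s \in
    (if (k < n)%N then map (cons k.+1) (parts L k.+1 (n - k.+1)) else [::]))
  = [&& (k < n)%N, a == k.+1 & is_part L k.+1 (n - k.+1) s].
  case: ifP => //= kn; apply/mapP/andP => [[t]|[/eqP -> ps]].
    by rewrite IHL => pt [-> ->].
  by exists s; rewrite ?IHL.
rewrite /is_part /= eqSS.
case: (size s == L) => //=; rewrite ?andbF //.
case: (boolP (a == k.+1)) => [/eqP -> /=|_]; last by rewrite !andbF !orbF.
rewrite /geq /= ltnn /=; case: (path _ _ s) => /=; rewrite ?andbF //.
by apply/andP/eqP => [[kn /eqP e]|e]; [|split; [|apply/eqP]]; lia.
Qed.

Lemma uniq_parts L k n : uniq (parts L k n).
Proof.
elim: L k n => [|L IHL] k n; first by rewrite /=; case: ifP.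
elim: k => [|k IHk]; first by rewrite parts0; case: ifP.
rewrite partsS cat_uniq IHk andTb; apply/andP; split; last first.
  by case: ifP => // _; rewrite map_inj_uniq // => s t [].
case: ifP => // _; apply/hasPn => _ /mapP[s _ ->].
by rewrite mem_parts /is_part /= /geq /= ltnn !andbF.
Qed.

(** Coefficientwise form of (1 - q^(k+1)) P_(k+1) = P_k, which matches the recursion of [parts]. *)
Lemma partgf_rec (R : comUnitRingType) k (n : nat) :
  ((partgf k.+1 : fps R) n) = (partgf k : fps R) n +
    (if (k < n)%N then (partgf k.+1 : fps R) (n - k.+1)%N else 0).
Proof.
have e : partgf k.+1 = partgf k + 'q ^+ k.+1 * partgf k.+1 :> fps R.
  apply: (mulrI (unit_1subX R (ltn0Sn k))).
  have -> : (1 - 'q ^+ k.+1) * partgf k.+1 = partgf k :> fps R.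
    by rewrite /partgf qfactS invrM ?unit_qfact ?unit_1subX // mulVKr ?unit_1subX.
  rewrite mulrDr mulrCA.
  have -> : (1 - 'q ^+ k.+1) * partgf k.+1 = partgf k :> fps R.
    by rewrite /partgf qfactS invrM ?unit_qfact ?unit_1subX // mulVKr ?unit_1subX.
  ring.
by rewrite {1}e coefqD coefqXnM ltnS; case: ltnP => //; rewrite leqNgt => /negPf ->.
Qed.

(** The hypothesis provides room for all nonzero parts, and it persists because removing a part
    lowers [n] by at least 1. *)
Lemma size_parts (R : comUnitRingType) L k n : (n <= L)%N ->
  (size (parts L k n))%:R = (partgf k : fps R) n.
Proof.
elim: L k n => [|L IHL] k n nL.
  have -> : n = 0%N by lia.
  by elim: k => [|k IHk]; [rewrite /partgf qpoch0 invr1|rewrite partgf_rec ltn0 addr0 -IHk].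
elim: k => [|k IHk].
  by rewrite parts0 /partgf qpoch0 invr1 coefq1; case: eqP.
rewrite partsS size_cat natrD IHk partgf_rec; congr (_ + _).
by case: ifP => // kn; rewrite size_map IHL //; lia.
Qed.

Lemma npartitionsE (R : comUnitRingType) n :
  (npartitions n)%:R = (partgf n : fps R) n.
Proof.
rewrite -(@size_parts R n) //; congr _%:R; rewrite /npartitions.
pose f (t : n.-tuple 'I_n.+1) := map val t.
have inj_f : injective f.
  by move=> s t /(inj_map val_inj) st; apply: val_inj.
rewrite cardE -(size_map f); apply/perm_size/uniq_perm.
- by rewrite map_inj_uniq ?enum_uniq.
- exact: uniq_parts.
move=> s; rewrite mem_parts /is_part; apply/mapP/and3P.
  move=> [t]; rewrite mem_enum inE => /andP[so su] ->.
  split => //; first by rewrite size_map size_tuple.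
  rewrite path_sortedE; last by move=> a b c /= ab bc; exact: leq_trans bc ab.
  by rewrite so andbT; apply/allP => _ /mapP[i _ ->]; rewrite /= -ltnS.
move=> [/eqP ss ps /eqP su].
have sb : all (fun a => a <= n)%N s.
  by move: ps; rewrite path_sortedE => [/andP[]//|a b c /= ab bc]; exact: leq_trans bc ab.
have st : size [seq (inord a : 'I_n.+1) | a <- s] == n by rewrite size_map ss.
have fs : map val [seq (inord a : 'I_n.+1) | a <- s] = s.
  rewrite -map_comp -[RHS]map_id; apply/eq_in_map => a sa /=.
  by rewrite inordK // ltnS (allP sb).
exists (Tuple st); rewrite /f /= ?fs // mem_enum inE /= fs su eqxx andbT.
exact: path_sorted ps.
Qed.

(** * Crank moments and the final identity *)

Lemma mu4_hsym2 n : mu4 n = ((partgf n * hsym2 int n) n)%:~R.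
Proof.
have [_ _ _ _ <-] := coef_crank_gf n; have uz := unit_zz.
rewrite crank_genfun // (@crank_sumE _ _ n); last first.
  by move=> m nm; rewrite crank_eq0 // mul0r.
rewrite mulr_sumr coefq_sum; apply: eq_bigr => i _.
set m := i%:Z - n%:Z.
have -> : z1 * ((crank m n)%:~R * z1 ^ m) = z1 ^ (m + 1) *~ crank m n.
  by rewrite exprzDr // expr1z -mulrzl; ring.
have [_ _ _ _ e] := binom_coefs_zz (m + 1).
rewrite coefq_mulrz e -[RHS]mulrzr /binz4; congr (_ * _).
by rewrite !intrM !intrB; field.
Qed.

Lemma crank_moment4 n : (crank_moment 4 n)%:~R =
  24 * ((partgf n * hsym2 int n) n)%:~R + 2 * ((partgf n * hsym1 int n) n)%:~R :> rat.
Proof.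
have [c1 c2 c3 c4 _] := coef_crank_gf n.
(* m^4 = 24 binom(m,4) + 36 binom(m,3) + 14 binom(m,2) + m, the coefficients being j! S(4,j) with
   Stirling numbers of the second kind. *)
transitivity (24 * crank_gf z1 z1^-1 n 4%N + 36 * crank_gf z1 z1^-1 n 3%N
  + 14 * crank_gf z1 z1^-1 n 2%N + crank_gf z1 z1^-1 n 1%N).
  rewrite !crank_sum_coef crank_momentE rmorph_sum !mulr_sumr -!big_split /=.
  apply: eq_bigr => i _; set m := i%:Z - n%:Z.
  have [_ -> -> -> ->] := binom_coefs_zz m.
  by rewrite rmorphM rmorphXn /=; field.
by rewrite c1 c2 c3 c4; ring.
Qed.

Theorem theorem1p2 (n : nat) :
  (spt_minus n)%:~R =
    5 / 72 * (crank_moment 4 n)%:~R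
    - 1 / 6 * n%:R ^+ 2 * (npartitions n)%:R
    + 1 / 36 * n%:R * (npartitions n)%:R
    - mu4 n :> rat.
Proof.
rewrite crank_moment4 mu4_hsym2 spt_minus_esym2.
have p0 : (npartitions n)%:Z = partgf n n by rewrite -npartitionsE natz.
have p1 : n%:Z * (npartitions n)%:Z = (partgf n * hsym1 int n) n.
  by rewrite p0 -(@qder_partgf_h1 int n n) //= natz.
set X2 := \sum_(1 <= k < n.+1) @dlambert int k ^+ 2.
set Y := \sum_(1 <= k < n.+1) k%:R * @ddlambert int k.
have p2 : n%:Z ^+ 2 * (npartitions n)%:Z =
    (partgf n * ((hsym1 int n) ^+ 2 + Y)) n.
  by rewrite p0 -(@qder2_partgf int n n) //= natz expr2 mulrA.
have ram : (partgf n * (2 * hsym1 int n ^+ 2)) n =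
    (partgf n * (5 * X2 + hsym1 int n - Y)) n.
  exact: (eqqMl _ (@ramanujan int n)).
have sq : hsym1 int n ^+ 2 = X2 + 2 * esym2 int n by exact: sqr_sum_dlambert.
rewrite hsym2E -/X2.
set P := partgf n in p1 p2 ram *.
(* All terms are now linear in [a], [s], [w], [h]; Ramanujan's equation eliminates [w]. *)
set a := (P * esym2 int n) n; set s := (P * X2) n; set w := (P * Y) n.
set h := (P * hsym1 int n) n in p1 *.
have eh2 : (P * (X2 + esym2 int n)) n = s + a by rewrite mulrDr.
have e2 : (P * (hsym1 int n ^+ 2 + Y)) n = s + a + a + w.
  rewrite sq; have -> : P * (X2 + 2 * esym2 int n + Y) =
    P * X2 + P * esym2 int n + P * esym2 int n + P * Y by ring.
  by rewrite !coefqD.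
have er : s + s + a + a + a + a = s + s + s + s + s + h - w.
  move: ram; rewrite sq.
  have -> : P * (2 * (X2 + 2 * esym2 int n)) = P * X2 + P * X2 + P * esym2 int n
    + P * esym2 int n + P * esym2 int n + P * esym2 int n by ring.
  have -> : P * (5 * X2 + hsym1 int n - Y) = P * X2 + P * X2 + P * X2 + P * X2 + P * X2
    + P * hsym1 int n - P * Y by ring.
  by rewrite !coefqD coefqN.
have ew : w = s + s + s + h - a - a - a - a by lia.
rewrite eh2; rewrite e2 ew in p2.
have q1 : n%:R * (npartitions n)%:R = h%:~R :> rat by rewrite -p1 intrM.
have q2 : n%:R ^+ 2 * (npartitions n)%:R =
    4 * s%:~R + h%:~R - 2 * a%:~R :> rat.
  transitivity ((n%:Z ^+ 2 * (npartitions n)%:Z)%:~R : rat); first by rewrite intrM rmorphXn.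
  by rewrite p2 !(intrD, rmorphN) /=; ring.
(* The coefficients of [s] and [h] cancel, and that of [a] is 5/3 + 1/3 - 1 = 1. *)
by rewrite -(mulrA (1 / 6)) q2 -(mulrA (1 / 36)) q1 intrD; field.
Qed.
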